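(* Let $K_1,K_2\subset\mathbb{R}^2$ be finite sets (of pixels), and let the underlying distance-function be $\delta(i,j,x,y)=(i-x)^2+(j-y)^2$. Let $\{\alpha(i,j):(i,j)\in K_1\}$, $\{\beta(x,y):(x,y)\in K_2\}$ be a feasible set of dual variables such that each pixel in $K_1$ and each pixel in $K_2$ has an admissible arc. Let $(i_0,j_0)\in K_1$ and let $(x_1,y_1),(x_2,y_1),(x_3,y_1)\in K_2$ be three pixels on the same line $y=y_1$ such that $i_0\le x_1<x_2<x_3$. Assume that both $(x_1,y_1)$ and $(x_2,y_1)$ are low with respect to $(i_0,j_0)$ and that $(x_2,y_1)$ is lower than $(x_1,y_1)$ (with respect to $(i_0,j_0)$). Then $(x_3,y_1)$ is also low with respect to $(i_0,j_0)$.
   Context: Dual variables are real numbers $\alpha(i,j)$, $(i,j)\in K_1$, and $\beta(x,y)$, $(x,y)\in K_2$. They are feasible if $\delta(i,j,x,y)-\alpha(i,j)-\beta(x,y)\ge 0$ for all $(i,j)\in K_1$, $(x,y)\in K_2$. A pair $\{(i,j),(x,y)\}$ with $(i,j)\in K_1$, $(x,y)\in K_2$ is an arc; it is admissible if $\alpha(i,j)+\beta(x,y)=\delta(i,j,x,y)$. A pixel of $K_1$ (or of $K_2$) has an admissible arc if it belongs to at least one admissible arc. A pixel $(x,y)\in K_2$ is low with respect to $(i,j)\in K_1$ if $\beta(x,y)<\delta(i,j,x,y)-\alpha(i,j)$. If two pixels $(x,y),(x',y')\in K_2$ are both low with respect to $(i,j)\in K_1$, then $(x',y')$ is lower than $(x,y)$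 (with respect to $(i,j)$) if $\delta(i,j,x',y')-\alpha(i,j)-\beta(x',y')\ge\delta(i,j,x,y)-\alpha(i,j)-\beta(x,y)$. *)

(* Defs.v *)
From HB Require Import structures.
From mathcomp Require Import all_boot all_order all_algebra finmap.
From mathcomp Require Import reals.

Set Implicit Arguments.
Unset Strict Implicit.
Unset Printing Implicit Defensive.

Import Order.TTheory GRing.Theory Num.Theory.

Local Open Scope fset_scope.
Local Open Scope ring_scope.

Definition sqdist (R : realType) (p q : R * R) : R :=
  (p.1 - q.1) ^+ 2 + (p.2 - q.2) ^+ 2.

Section DualVariables.

(* The dual variables are total functions on the plane; only the values of
   [alpha] on [K1] and of [beta] on [K2] are ever constrained. *)
Variables (R : realType) (delta : R * R -> R * R -> R).
Variables (K1 K2 : {fset R * R}) (alpha beta : R * R -> R).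

Definition feasible : Prop :=
  forall p q, p \in K1 -> q \in K2 -> 0 <= delta p q - alpha p - beta q.

Definition admissible (p q : R * R) : Prop :=
  [/\ p \in K1, q \in K2 & alpha p + beta q = delta p q].

Definition has_admissible_arc1 (p : R * R) : Prop :=
  exists q, admissible p q.

Definition has_admissible_arc2 (q : R * R) : Prop :=
  exists p, admissible p q.

Definition low (p q : R * R) : Prop :=
  [/\ p \in K1, q \in K2 & beta q < delta p q - alpha p].

(* [lower p q q'] : with respect to [p], the pixel [q'] is lower than [q]; ties
   are allowed, and the comparison only makes sense between low pixels. *)
Definition lower (p q q' : R * R) : Prop :=
  [/\ low p q, low p q' &
      delta p q - alpha p - beta q <= delta p q' - alpha p - beta q'].

End DualVariables.

(* Main.v *)
(* Let (a, b) be the other end of an admissible arc at (x2, y1).  Feasibility at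
   (x1, y1), together with (x2, y1) being lower than (x1, y1), forces i0 <= a.
   Going from x2 to the right, squared distances to (i0, j0) then grow at least
   as fast as those to (a, b), which bound beta at (x3, y1). *)

Require Import Defs.
From HB Require Import structures.
From mathcomp Require Import all_boot all_order all_algebra finmap.
From mathcomp Require Import reals lra.

Set Implicit Arguments.
Unset Strict Implicit.
Unset Printing Implicit Defensive.

Import Order.TTheory GRing.Theory Num.Theory.

Local Open Scope fset_scope.
Local Open Scope ring_scope.

Theorem theorem2 (R : realType) (K1 K2 : {fset R * R})
    (alpha beta : R * R -> R)
    (hfeas : feasible (@sqdist R) K1 K2 alpha beta)
    (hadm1 : forall p, p \in K1 ->
       has_admissible_arc1 (@sqdist R) K1 K2 alpha beta p)
    (hadm2 : forall q, q \in K2 ->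
       has_admissible_arc2 (@sqdist R) K1 K2 alpha beta q)
    (i0 j0 x1 x2 x3 y1 : R)
    (hp : (i0, j0) \in K1)
    (hq1 : (x1, y1) \in K2) (hq2 : (x2, y1) \in K2) (hq3 : (x3, y1) \in K2)
    (hi0 : i0 <= x1) (h12 : x1 < x2) (h23 : x2 < x3)
    (hlow1 : low (@sqdist R) K1 K2 alpha beta (i0, j0) (x1, y1))
    (hlow2 : low (@sqdist R) K1 K2 alpha beta (i0, j0) (x2, y1))
    (hlower : lower (@sqdist R) K1 K2 alpha beta (i0, j0) (x1, y1) (x2, y1)) :
  low (@sqdist R) K1 K2 alpha beta (i0, j0) (x3, y1).
Proof.
have [[a b] [pK1 _ tight2]] := hadm2 _ hq2.
have feas1 := hfeas _ _ pK1 hq1.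
have feas3 := hfeas _ _ pK1 hq3.
have [_ _ low2] := hlow2.
have [_ _ lower12] := hlower.
rewrite /sqdist /= in tight2 feas1 feas3 low2 lower12.
split=> //; rewrite /sqdist /=.
have i0a : i0 <= a.
  (* Adding [feas1] and [lower12] and eliminating [alpha (a, b)] by [tight2] cancels all dual
     variables and squares; what remains is twice this product, so [lra] can treat the monomials as
     atoms. *)
  have : 0 <= (a - i0) * (x2 - x1) by lra.
  by rewrite pmulr_lge0 ?subr_gt0 ?subr_ge0.
(* Twice this product is the growth of the squared distance to [(i0, j0)] from [x2] to [x3] minus
   that to [(a, b)]. By [feas3] and [tight2] the latter bounds the increase of [beta]; strictness
   comes from [low2]. *)
have : 0 <= (a - i0) * (x3 - x2) by rewrite mulr_ge0 // subr_ge0 // ltW.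
lra.
Qed.
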